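(* For every integer $k\ge 1$, there are only finitely many $k$-vertex-critical $(2P_2,bull)$-free graphs.
   Context: Graphs are finite and simple, and ''finitely many'' means up to isomorphism. A graph $G$ is $k$-vertex-critical if $\chi(G)=k$ and $\chi(G-v)<k$ for all $v\in V(G)$, where $\chi$ denotes the chromatic number. A graph is $(H_1,H_2)$-free if it contains no induced subgraph isomorphic to $H_1$ or $H_2$. $P_n$ is the path on $n$ vertices and $2P_2$ is the disjoint union of two copies of $P_2$ (two disjoint edges with no edges between them). The $bull$ is the 5-vertex graph obtained from a triangle $K_3$ by attaching two leaves (pendant vertices), each to a different vertex of the triangle. *)

(* Defs.v *)
From mathcomp Require Import all_boot.

Set Implicit Arguments.
Unset Strict Implicit.
Unset Printing Implicit Defensive.

Record sgraph := SGraph {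
  vertex :> finType;
  edge : rel vertex;
  edge_sym : symmetric edge;
  edge_irrefl : irreflexive edge
}.

Definition iso (G H : sgraph) : Prop :=
  exists2 f : G -> H, bijective f & forall x y, edge (f x) (f y) = edge x y.

Section Induced.
Variables (G : sgraph) (S : {set G}).

Definition induced_edge : rel {x : G | x \in S} :=
  fun x y => edge (val x) (val y).

Lemma induced_edge_sym : symmetric induced_edge.
Proof. by move=> x y; apply: edge_sym. Qed.

Lemma induced_edge_irrefl : irreflexive induced_edge.
Proof. by move=> x; apply: edge_irrefl. Qed.

Definition induced : sgraph := SGraph induced_edge_sym induced_edge_irrefl.

End Induced.

Definition delete_vertex (G : sgraph) (v : G) : sgraph := induced [set~ v].

Definition contains_induced (G H : sgraph) : Prop :=
  exists S : {set G}, iso (induced S) H.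

Definition free2 (H1 H2 G : sgraph) : Prop :=
  ~ contains_induced G H1 /\ ~ contains_induced G H2.

Definition proper_coloring (G : sgraph) (k : nat) (c : {ffun G -> 'I_k}) : bool :=
  [forall x, forall y, edge x y ==> (c x != c y)].

Definition colorable (G : sgraph) (k : nat) : bool :=
  [exists c : {ffun G -> 'I_k}, proper_coloring c].

Lemma colorable_exists (G : sgraph) : exists k, colorable G k.
Proof.
exists #|G|; apply/existsP; exists [ffun x => enum_rank x].
apply/forallP=> x; apply/forallP=> y; apply/implyP=> xy; rewrite !ffunE.
by apply: contraTneq xy => /enum_rank_inj->; rewrite edge_irrefl.
Qed.

Definition chi (G : sgraph) : nat := ex_minn (colorable_exists G).

Definition vertex_critical (k : nat) (G : sgraph) : Prop :=
  chi G = k /\ forall v : G, chi (delete_vertex v) < k.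

Definition path_edge (n : nat) : rel 'I_n :=
  fun i j => (i.+1 == j :> nat) || (j.+1 == i :> nat).

Lemma path_edge_sym n : symmetric (@path_edge n).
Proof. by move=> i j; rewrite /path_edge orbC. Qed.

Lemma path_edge_irrefl n : irreflexive (@path_edge n).
Proof. by move=> i; rewrite /path_edge orbb gtn_eqF. Qed.

Definition path_graph (n : nat) : sgraph :=
  SGraph (@path_edge_sym n) (@path_edge_irrefl n).

Section DisjointUnion.
Variables G H : sgraph.

Definition union_edge : rel (G + H)%type := fun u v =>
  match u, v with
  | inl x, inl y => edge x y
  | inr x, inr y => edge x y
  | _, _ => false
  end.

Lemma union_edge_sym : symmetric union_edge.
Proof. by move=> [x|x] [y|y] //=; apply: edge_sym. Qed.

Lemma union_edge_irrefl : irreflexive union_edge.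
Proof. by move=> [x|x] /=; apply: edge_irrefl. Qed.

Definition disjoint_union : sgraph := SGraph union_edge_sym union_edge_irrefl.

End DisjointUnion.

Definition two_P2 : sgraph := disjoint_union (path_graph 2) (path_graph 2).

(* The triangle is 0, 1, 2; the leaves 3 and 4 are attached to 0 and 1. *)
Definition bull_edges : seq (nat * nat) :=
  [:: (0, 1); (0, 2); (1, 2); (0, 3); (1, 4)].

Definition bull_edge : rel 'I_5 := fun i j =>
  ((i : nat, j : nat) \in bull_edges) || ((j : nat, i : nat) \in bull_edges).

Lemma bull_edge_sym : symmetric bull_edge.
Proof. by move=> i j; rewrite /bull_edge orbC. Qed.

Lemma bull_edge_irrefl : irreflexive bull_edge.
Proof. by case; do 5?[case=> //]. Qed.

Definition bull : sgraph := SGraph bull_edge_sym bull_edge_irrefl.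

(* The representatives F i need not satisfy P: discarding the classes on which
   P fails only shortens the list. *)
Definition finitely_many_upto_iso (P : sgraph -> Prop) : Prop :=
  exists (n : nat) (F : 'I_n -> sgraph),
    forall G : sgraph, P G -> exists i : 'I_n, iso G (F i).

(* Main.v *)
Require Import Defs.
From mathcomp Require Import all_boot.

Set Implicit Arguments.
Unset Strict Implicit.
Unset Printing Implicit Defensive.

(** Let S be an independent set of a (2P2, bull)-free graph. The traces
    N(v) ∩ S form a laminar family: two vertices with incomparable traces are
    adjacent, since otherwise there is a 2P2, and then their traces are
    disjoint, since otherwise there is a bull. In a vertex-critical graph no
    neighbourhood contains another, so the traces separate the points of S in
    both directions. By laminarity a smallest trace containing s is therefore
    {s}. The vertices realising these singletons form a clique, so a colouring
    with k colours gives |S| <= k. As the k colour classes are independent, G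
    has at most k * k vertices. *)

(** * Induced copies of 2P2 and of the bull *)

Lemma contains_induced_embedding (G H : sgraph) (f : H -> G) :
  injective f -> (forall x y, edge (f x) (f y) = edge x y) ->
  contains_induced G H.
Proof.
move=> f_inj f_edge; exists (f @: [set: H]).
have fP x : f x \in f @: [set: H] by apply: imset_f.
pose h x : induced (f @: [set: H]) := exist _ (f x) (fP x).
have h_inj : injective h by move=> x y /(congr1 val)/f_inj.
have [|g hK gK] := inj_card_bij h_inj.
  by rewrite card_sig card_imset // cardsT.
exists g; first by exists h.
by move=> x y; rewrite -[in RHS](gK x) -[in RHS](gK y) /= /induced_edge /= f_edge.
Qed.

Lemma two_P2_free_edge (G : sgraph) (a b c d : G) :
  ~ contains_induced G two_P2 -> edge a b -> edge c d ->
  ~~ edge a d -> ~~ edge b c -> ~~ edge b d -> edge a c.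
Proof.
move=> noP ab cd ad bc bd; apply/negP => /negP ac; case: noP.
pose pt (x y : G) (i : 'I_2) := if i == 0 :> nat then x else y.
pose f (z : two_P2) : G :=
  match z with inl i => pt a b i | inr i => pt c d i end.
have f_edge x y : edge (f x) (f y) = edge x y.
  move: x y => [[[|[|//]] ?]|[[|[|//]] ?]] [[[|[|//]] ?]|[[|[|//]] ?]];
    rewrite /f /pt /= /path_edge /= ?edge_irrefl //;
    by [| apply/negbTE | rewrite edge_sym | rewrite edge_sym; apply/negbTE].
apply: (@contains_induced_embedding G _ f) => // x y fxy.
(* Vertices with equal images have equal neighbourhoods, and distinct vertices of 2P2 have distinct
   neighbourhoods, so [f] is injective. *)
have {fxy} E z : edge (y : two_P2) z = edge x z by rewrite -!f_edge fxy.
move: x y E => [[[|[|//]] ?]|[[|[|//]] ?]] [[[|[|//]] ?]|[[|[|//]] ?]] E;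
  try by congr (_ _); apply: val_inj.
all: by have := E (inl ord0); have := E (inl ord_max);
  have := E (inr ord0); have := E (inr ord_max).
Qed.

Lemma bull_free_contra (G : sgraph) (u v s a b : G) :
  ~ contains_induced G bull -> edge u v -> edge u s -> edge v s ->
  edge u a -> edge v b -> ~~ edge v a -> ~~ edge u b ->
  ~~ edge s a -> ~~ edge s b -> ~~ edge a b -> False.
Proof.
move=> noB uv us vs ua vb va ub sa sb ab; apply: noB.
(* The triangle is [u], [v], [s]; the leaf [a] hangs at [u] and [b] at [v]. *)
pose f (i : bull) : G := nth u [:: u; v; s; a; b] i.
have f_edge x y : edge (f x) (f y) = edge x y.
  move: x y => [[|[|[|[|[|//]]]]] ?] [[|[|[|[|[|//]]]]] ?];
    rewrite /f /= /bull_edge /= ?edge_irrefl //;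
    by [| apply/negbTE | rewrite edge_sym | rewrite edge_sym; apply/negbTE].
apply: (@contains_induced_embedding G _ f) => // x y fxy.
(* The five vertices of the bull also have pairwise distinct neighbourhoods. *)
have {fxy} E z : edge (y : bull) z = edge x z by rewrite -!f_edge fxy.
move: (E (inord 0)) (E (inord 1)) (E (inord 2)) (E (inord 3)) (E (inord 4)).
rewrite /= /bull_edge !inordK //.
move: x y {E} => [[|[|[|[|[|//]]]]] ?] [[|[|[|[|[|//]]]]] ?] //= *;
  exact: val_inj.
Qed.

(** * Colourings and vertex-criticality *)

Lemma chi_colorable (G : sgraph) : colorable G (chi G).
Proof. by rewrite /chi; case: ex_minnP. Qed.

Lemma chi_min (G : sgraph) j : colorable G j -> chi G <= j.
Proof. by rewrite /chi; case: ex_minnP => n _; apply. Qed.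

Lemma proper_coloringP (G : sgraph) k (c : {ffun G -> 'I_k}) :
  reflect (forall x y, edge x y -> c x != c y) (proper_coloring c).
Proof.
apply: (iffP forallP) => [E x y | E x]; first by move/forallP/(_ y)/implyP: (E x).
by apply/forallP => y; apply/implyP/E.
Qed.

(** If every neighbour of [s] were a neighbour of [t], a colouring of G - s would extend to G by
    giving [s] the colour of [t], against criticality. *)
Lemma vertex_critical_separates (G : sgraph) k (s t : G) :
  vertex_critical k G -> s != t -> exists2 v, edge s v & ~~ edge t v.
Proof.
move=> [chiG crit] st.
case: (boolP [exists v, edge s v && ~~ edge t v]) => [/existsP[v /andP[]]|].
  by exists v.
rewrite negb_exists => /forallP sub.
have {}sub v : edge s v -> edge t v.
  by move=> sv; have := sub v; rewrite sv negbK.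
suff /chi_min : colorable G (chi (delete_vertex s)) by rewrite chiG leqNgt crit.
have /existsP[c /proper_coloringP cP] := chi_colorable (delete_vertex s).
have tS : t \in [set~ s] by rewrite !inE eq_sym.
pose t' : delete_vertex s := exist _ t tS.
(* The default value [t'] is taken only at [s]: [r] folds [s] onto [t] and fixes all other
   vertices. *)
pose r x : delete_vertex s := insubd t' x.
have rK x : x != s -> val (r x) = x.
  by move=> xs; rewrite /r val_insubd !inE xs.
have rs : val (r s) = t by rewrite /r val_insubd !inE eqxx.
have r_edge x y : edge x y -> edge (val (r x)) (val (r y)).
  move=> xy; have [xs | xs] := eqVneq x s; have [ys | ys] := eqVneq y s.
  - by rewrite xs ys edge_irrefl in xy.
  - by rewrite xs rs rK //; apply: sub; rewrite -xs.
  - by rewrite ys rs rK // edge_sym; apply: sub; rewrite -ys edge_sym.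
  - by rewrite !rK.
apply/existsP; exists [ffun x => c (r x)].
by apply/proper_coloringP => x y xy; rewrite !ffunE; apply/cP/r_edge.
Qed.

(** * Traces of neighbourhoods on an independent set *)

Definition trace {G : sgraph} (S : {set G}) (v : G) : {set G} :=
  [set s in S | edge s v].

Definition independent {G : sgraph} (S : {set G}) : Prop :=
  {in S &, forall x y, ~~ edge x y}.

Section IndependentSet.
Variables (G : sgraph) (S : {set G}).
Hypothesis indS : independent S.

Lemma private_neighbors_adjacent (u v s t : G) :
  ~ contains_induced G two_P2 ->
  s \in trace S u -> s \notin trace S v ->
  t \in trace S v -> t \notin trace S u -> edge u v.
Proof.
rewrite !inE => noP /andP[sS su]; rewrite sS /= => sv /andP[tS tv].
rewrite tS /= => tu; apply: (@two_P2_free_edge G u s v t) => //.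
- by rewrite edge_sym.
- by rewrite edge_sym.
- by rewrite edge_sym.
- exact: indS.
Qed.

Lemma trace_laminar (u v s : G) :
  free2 two_P2 bull G -> s \in trace S u -> s \in trace S v ->
  (trace S u \subset trace S v) || (trace S v \subset trace S u).
Proof.
move=> [noP noB] su sv; apply/norP => -[/subsetPn[a au av] /subsetPn[b bv bu]].
have uv := private_neighbors_adjacent noP au av bv bu.
move: su sv au av bv bu; rewrite !inE.
move=> /andP[sS su] /andP[_ sv] /andP[aS au]; rewrite aS /= => av /andP[bS bv].
rewrite bS /= => bu; apply: (@bull_free_contra G u v s a b) => //;
  by [rewrite edge_sym | apply: indS].
Qed.

Lemma singleton_trace k (s : G) :
  vertex_critical k G -> free2 two_P2 bull G -> 1 < #|S| -> s \in S ->
  exists v, trace S v = [set s].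
Proof.
move=> crit freeG S_gt1 sS.
(* Separating [s] from a second point of [S] provides a neighbour of [s], so a neighbour with
   smallest trace exists. *)
have [t] : exists t, t \in S :\ s.
  by apply/set0Pn; rewrite -card_gt0; move: S_gt1; rewrite (cardsD1 s) sS.
rewrite !inE eq_sym => /andP[st _].
have [v0 sv0 _] := vertex_critical_separates crit st.
case: (arg_minnP (fun v => #|trace S v|) sv0) => v sv v_min.
have s_in w : edge s w -> s \in trace S w by rewrite !inE sS.
exists v; apply/eqP; rewrite eq_sym eqEsubset sub1set s_in //=.
apply/subsetP => x xv; rewrite inE; apply: contraT; rewrite eq_sym => sx.
(* The trace of [w] contains [s] but not [x], so by laminarity it lies strictly inside that of [v],
   against minimality. *)
have [w sw xw] := vertex_critical_separates crit sx.
have xNw : x \notin trace S w by rewrite inE (negbTE xw) andbF.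
have /orP[/subsetP/(_ x xv)|wv] := trace_laminar freeG (s_in v sv) (s_in w sw).
  by rewrite (negbTE xNw).
have := v_min w sw; rewrite leqNgt proper_card //.
by apply/properP; split => //; exists x.
Qed.

Lemma independent_card_le k :
  0 < k -> vertex_critical k G -> free2 two_P2 bull G -> #|S| <= k.
Proof.
move=> k_gt0 crit freeG.
have [S_le1 | S_gt1] := leqP #|S| 1; first exact: leq_trans k_gt0.
have /fin_all_exists[w wP] s : exists v, s \in S -> trace S v = [set s].
  case: (boolP (s \in S)) => [sS | _]; last by exists s.
  by have [v sv] := singleton_trace crit freeG S_gt1 sS; exists v.
have := chi_colorable G; rewrite crit.1 => /existsP[c /proper_coloringP cP].
suff cw_inj : {in S &, injective (fun s => c (w s))}.
  by rewrite -(card_in_imset cw_inj) -[leqRHS]card_ord max_card.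
(* The traces {s} and {t} are incomparable, so [w s] and [w t] are adjacent and get different
   colours. *)
move=> s t sS tS cst; apply: contraTeq isT => st.
suff /cP : edge (w s) (w t) by rewrite cst eqxx.
by apply: (private_neighbors_adjacent (s := s) (t := t) freeG.1);
  rewrite wP // !inE // eq_sym.
Qed.

End IndependentSet.

Lemma critical_card_le (G : sgraph) k :
  0 < k -> vertex_critical k G -> free2 two_P2 bull G -> #|G| <= k * k.
Proof.
move=> k_gt0 crit freeG.
have := chi_colorable G; rewrite crit.1 => /existsP[c /proper_coloringP cP].
rewrite -sum1_card (partition_big c predT) //= -[k in k * _]card_ord -sum_nat_const.
apply: leq_sum => i _; rewrite sum1_card -cardsE.
apply: independent_card_le => // x y; rewrite !inE => /eqP cx /eqP cy.
by apply/negP => /cP/eqP; apply; apply: val_inj; rewrite /= cx cy.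
Qed.

(** * Finiteness from a bound on the order *)

Section Codes.
Variable m : nat.
Variable e : {ffun 'I_m * 'I_m -> bool}.

(** Symmetrising and removing loops makes every boolean table [e] encode a graph. *)
Definition code_edge : rel 'I_m :=
  fun x y => (x != y) && (e (x, y) || e (y, x)).

Lemma code_edge_sym : symmetric code_edge.
Proof. by move=> x y; rewrite /code_edge eq_sym orbC. Qed.

Lemma code_edge_irrefl : irreflexive code_edge.
Proof. by move=> x; rewrite /code_edge eqxx. Qed.

Definition code_graph : sgraph := SGraph code_edge_sym code_edge_irrefl.

End Codes.

Lemma iso_code_graph (G : sgraph) :
  iso G (code_graph [ffun p : 'I_#|G| * 'I_#|G| => edge (enum_val p.1) (enum_val p.2)]).
Proof.
exists enum_rank; first exact: enum_rank_bij.
move=> x y; rewrite /= /code_edge !ffunE /= !enum_rankK.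
rewrite (inj_eq enum_rank_inj) [edge y x]edge_sym orbb.
by have [->|//] := eqVneq x y; rewrite edge_irrefl.
Qed.

Lemma finitely_many_bounded_card (P : sgraph -> Prop) N :
  (forall G : sgraph, P G -> #|G| <= N) -> finitely_many_upto_iso P.
Proof.
(* An order from 0 to [N] together with a table of that size: a finite type whose enumeration lists
   the representatives. *)
move=> bound; pose T := {m : 'I_N.+1 & {ffun 'I_m * 'I_m -> bool}}.
exists #|{: T}|, (fun i => let t := enum_val i in code_graph (tagged t)).
move=> G /bound; rewrite -ltnS => ltGN.
pose t : T := Tagged (fun m : 'I_N.+1 => {ffun 'I_m * 'I_m -> bool})
  (i := Ordinal ltGN) [ffun p => edge (enum_val p.1) (enum_val p.2)].
by exists (enum_rank t); rewrite enum_rankK; apply: iso_code_graph.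
Qed.

Theorem theorem3p2 (k : nat) (hk : 1 <= k) :
  finitely_many_upto_iso
    (fun G : sgraph => vertex_critical k G /\ free2 two_P2 bull G).
Proof.
apply: (@finitely_many_bounded_card _ (k * k)) => G [crit freeG].
exact: critical_card_le.
Qed.
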